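(* For every positive integer $k$, \[\frac{k^2+2k+3}{4}\leqslant m(\mathbb{O}_k,2)\leqslant\frac{k^2+5k+3}{3},\] where $\mathbb{O}_k$ is the odd graph on the ground set $\{1,\ldots,2k+1\}$.
   Context: All graphs are finite, undirected, without multiple edges or loops. Odd graph: for a positive integer $k$, $\mathbb{O}_k$ is the graph whose vertices are the $k$-subsets of $\{1,\ldots,2k+1\}$, in which two vertices $S$ and $T$ are adjacent if $S\cap T=\varnothing$. $r$-neighbor bootstrap percolation: given a graph $G$, an integer $r\geqslant 0$ and a set $V_0\subseteq V(G)$ of initially active vertices, for each integer $i\geqslant 1$ let $V_i=V_{i-1}\cup\{v\in V(G) : v \text{ is adjacent to at least } r \text{ vertices in } V_{i-1}\}$. The set $V_0$ is a percolating set if $V_t=V(G)$ for some integer $t\geqslant 0$. $m(G,r)$ denotes the minimum cardinality of a percolating set in this process. *)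

(* Defs.v *)
From mathcomp Require Import all_boot.

Set Implicit Arguments.
Unset Strict Implicit.
Unset Printing Implicit Defensive.

(* A graph on a finite vertex type [T] is given by its adjacency relation
   [e : rel T]; see [odd_adj_sym] and [odd_adj_irrefl] for the odd graph. *)

Section Bootstrap.
Variables (T : finType) (e : rel T) (r : nat).

Definition bootstrap_step (A : {set T}) : {set T} :=
  A :|: [set v | r <= #|[set u in A | e v u]|].

Definition bootstrap (A : {set T}) (i : nat) : {set T} :=
  iter i bootstrap_step A.

Definition percolating (A : {set T}) : Prop :=
  exists t : nat, bootstrap A t = [set: T].

Lemma bootstrap_sub A i j : i <= j -> bootstrap A i \subset bootstrap A j.
Proof.
move=> le_ij; rewrite -(subnK le_ij); elim: (j - i) => [|n IHn] //.
by rewrite addSn (subset_trans IHn) //= subsetUl.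
Qed.

Lemma bootstrap_stable A n :
  n <= #|bootstrap A n| \/ bootstrap A n.+1 = bootstrap A n.
Proof.
elim: n => [|n [le_n|eq_n]]; first by left.
  have sub := bootstrap_sub A (leqnSn n).
  case: (eqVneq (bootstrap A n.+1) (bootstrap A n)) => [eq_n|ne_n].
    by right; rewrite /bootstrap iterS -/(bootstrap A n.+1) eq_n.
  left; apply: leq_ltn_trans le_n _; apply: proper_card.
  by rewrite properEneq eq_sym ne_n.
by right; rewrite /bootstrap iterS -/(bootstrap A n.+1) eq_n.
Qed.

(* A step that is not yet stationary adds a vertex, so #|T| steps suffice. *)
Lemma percolatingP A :
  reflect (percolating A) (bootstrap A #|T| == [set: T]).
Proof.
apply: (iffP eqP) => [perc|[t perc]]; first by exists #|T|.
case: (bootstrap_stable A #|T|) => [full|stable].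
  by apply/eqP; rewrite eqEcard subsetT cardsT.
have {}stable n : bootstrap A (n + #|T|) = bootstrap A #|T|.
  by elim: n => // n IHn; rewrite addSn /bootstrap iterS -/(bootstrap _ _) IHn.
apply/eqP; rewrite eqEsubset subsetT /= -perc -(stable t).
exact/bootstrap_sub/leq_addr.
Qed.

Definition percolating_dec A : decidable (percolating A) :=
  decP (percolatingP A).

Lemma percolatingT : percolating [set: T].
Proof. by exists 0. Qed.

(* The full vertex set, which percolates, seeds the minimization. *)
Definition min_percolating : nat :=
  #|[arg min_(A < [set: T] | percolating_dec A) #|A|]|.

Lemma min_percolating_witness :
  exists2 A, percolating A & #|A| = min_percolating.
Proof.
rewrite /min_percolating; case: arg_minnP => [|A /sumboolP perc _].
  exact/sumboolP/percolatingT.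
by exists A.
Qed.

Lemma min_percolating_le A : percolating A -> min_percolating <= #|A|.
Proof.
move=> perc; rewrite /min_percolating; case: arg_minnP => [|B _].
  exact/sumboolP/percolatingT.
by apply; apply/sumboolP.
Qed.

End Bootstrap.

(* The ground set {1, ..., 2k+1} is represented by 'I_(2k+1). *)
Definition odd_vertex (k : nat) : finType :=
  {S : {set 'I_(2 * k + 1)} | #|S| == k}.

Definition odd_adj (k : nat) : rel (odd_vertex k) :=
  fun S T => [disjoint val S & val T].

Lemma odd_adj_sym k : symmetric (@odd_adj k).
Proof. by move=> S T; rewrite /odd_adj disjoint_sym. Qed.

Lemma odd_adj_irrefl k : 0 < k -> irreflexive (@odd_adj k).
Proof.
move=> k_gt0 S; apply/negbTE; rewrite /odd_adj -setI_eq0 setIid -cards_eq0.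
by rewrite (eqP (valP S)) -lt0n.
Qed.

(* Main.v *)
Require Import Defs.
From mathcomp Require Import all_boot all_order all_algebra.
From mathcomp Require Import ring zify.
Import Order.TTheory GRing.Theory Num.Theory.

Set Implicit Arguments.
Unset Strict Implicit.
Unset Printing Implicit Defensive.

(** Lower bound. Give the elements i of the ground set distinct numbers x_i, and let
    P_S be the product of the X - x_i for i in S. An edge {S, T} leaves out exactly
    one element u; attach to it the wedge (X - x_u) P_S /\ (X - x_u) P_T in the
    exterior square of the polynomials of degree at most k + 1. For fixed S the
    product (X - x_u) P_T is P_(~: S), so these vectors are affine in x_u: any two
    edges at S determine all the others. Hence an alternating form that vanishes at
    all edges of two neighbours of S vanishes at all edges of S ([dead_step]). If A
    percolates, 2 #|A| linear conditions thus force a form to vanish on every edge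
    vector, and then it is zero ([alternating_eq0]). So 2 #|A| is at least
    'C(k + 2, 2), the dimension of the space of forms, which is a little more than
    the bound requires.

    Upper bound. Replace a vertex by the pair consisting of a k-set and its
    complement, so that the process lives on the two middle layers of the Boolean
    lattice. In an interval [B, D] of the lattice, the deletion of one element from
    B costs about (#|D| - k) / 2 seeds ([removal_seeds]). With k = j + a and disjoint
    a-sets P and Q, the interval [Q, ~: P] and with it its antipode [P, ~: Q] cost
    about j^2 / 2 seeds, and an interval that contains P, Q and a further a-set in
    its free part costs about a^2. From there on everything becomes active at no
    cost, since a set that meets both P and Q is reached from the two sides
    ([spread_remove]). The choice a = k / 3 gives k^2 / 3 + O(k). *)

(** * Seeds for the upper bound *)

Ltac case_atoms := repeat match goal with
  | |- context [?a == ?b] => case: (eqVneq a b) => [?|?]; subst => //=;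
      try match goal with H : is_true (?c != ?c) |- _ => by case/eqP: H end
  end; repeat match goal with
  | |- context [?a \in ?A] => case: (a \in A) => //=
  end.

(** Solves a membership goal at the point i from the inclusions and memberships
    in the context. *)
Ltac set_at i := repeat match goal with
  | H : is_true (_ \subset _) |- _ => generalize (subsetP H i); clear H
  | H : is_true (_ \in _) |- _ => revert H
  | H : is_true (~~ _) |- _ => revert H
  end; rewrite !inE; clear; case_atoms;
  intros; exfalso; match goal with
  | H : is_true true -> is_true false |- _ => discriminate (H isT)
  end.
Ltac subset_tac := let i := fresh "i" in apply/subsetP => i; set_at i.
Ltac seteq_tac := let i := fresh "i" in apply/setP => i; set_at i.

(** Cardinal arithmetic: membership hypotheses would only make [lia] branch. *)
Ltac card_lia := repeat match goal with
  | H : is_true (_ \subset _) |- _ => clear H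
  | H : is_true (_ \in _) |- _ => clear H
  | H : is_true (~~ _) |- _ => clear H
  | H : is_true (_ || _) |- _ => clear H
  | H : is_true (_ && _) |- _ => clear H
  end; lia.

Lemma exists_subset_card (T : finType) (A C : {set T}) m :
  A \subset C -> #|A| <= m -> m <= #|C| ->
  exists Z : {set T}, [/\ A \subset Z, Z \subset C & #|Z| = m].
Proof.
move=> sAC; elim: m => [|m IHm] le_A le_m.
  by exists A; split=> //; apply/eqP; rewrite -leqn0.
case: (ltngtP #|A| m.+1) le_A => // [lt_A _|eq_A _]; last by exists A.
have [Z [sAZ sZC card_Z]] := IHm lt_A (ltnW le_m).
have /subsetPn[x xC xZ] : ~~ (C \subset Z).
  by apply: contraL le_m => /subset_leq_card; rewrite card_Z -ltnNge ltnS.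
exists (x |: Z); split; [by subset_tac | by subset_tac | by rewrite cardsU1 xZ card_Z].
Qed.

Section OddUpper.
Variables (T : finType) (k : nat).
Hypothesis card_T : #|T| = 2 * k + 1.
Implicit Types (K : {set T} -> Prop) (B C D P Q U X : {set T}).

(** The middle layers picture of the process: a vertex S is represented both by
    the k-set S and by the k.+1-set ~: S. A neighbour of S is then the k-set
    obtained from ~: S by deleting one element, and K U with #|U| = k.+1 means
    that the vertex ~: U is active. *)
Definition spreading K : Prop :=
  (forall X, K X -> K (~: X)) /\
  (forall U x y, #|U| = k.+1 -> x \in U -> y \in U -> x != y ->
     K (U :\ x) -> K (U :\ y) -> K U).

Lemma cardsC_T X : #|X| + #|~: X| = 2 * k + 1.
Proof. by rewrite cardsC card_T. Qed.

(** Complementation exchanges the k-sets and the k.+1-sets, so the activation rule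
    can be read downwards as well. *)
Lemma spreading_down K X x y : spreading K -> #|X| = k -> x \notin X ->
  y \notin X -> x != y -> K (x |: X) -> K (y |: X) -> K X.
Proof.
move=> sprK card_X xX yX neq_xy Kx Ky; rewrite -[X]setCK.
apply: sprK.1; apply: (sprK.2 _ x y); rewrite ?inE //.
- by have := cardsC_T X; card_lia.
- by rewrite (_ : ~: X :\ x = ~: (x |: X)); [exact: sprK.1 | seteq_tac].
- by rewrite (_ : ~: X :\ y = ~: (y |: X)); [exact: sprK.1 | seteq_tac].
Qed.

(** Only the upper layer of the interval between B and D is recorded: when D has
    at least k.+2 elements it determines the lower one ([known_lower]), and an
    interval whose lower layer is {B} is seeded through its upper layer. *)
Definition known K B D : Prop :=
  forall U, B \subset U -> U \subset D -> #|U| = k.+1 -> K U.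

Lemma known_sub K B D B' D' : B \subset B' -> D' \subset D ->
  known K B D -> known K B' D'.
Proof.
move=> sB sD kn U sBU sUD; apply: kn; first exact: subset_trans sBU.
exact: subset_trans sUD _.
Qed.

Lemma card_setD_ge (A X : {set T}) : #|X| - #|A| <= #|X :\: A|.
Proof. by rewrite cardsD leq_sub2l // subset_leq_card // subsetIr. Qed.

Lemma exists_two (A : {set T}) : 1 < #|A| ->
  exists x y, [/\ x \in A, y \in A & x != y].
Proof. by move/card_gt1P=> [x [y []]]; exists x, y. Qed.

Lemma known_lower K B D X : spreading K -> known K B D -> k.+1 < #|D| ->
  B \subset X -> X \subset D -> #|X| = k -> K X.
Proof.
move=> sprK kn lt_D sBX sXD card_X.
have /exists_two[x [y []]] : 1 < #|D :\: X|.
  by apply: leq_trans (card_setD_ge _ _); card_lia.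
rewrite !inE => /andP[xX xD] /andP[yX yD] neq_xy.
apply: (spreading_down (x := x) (y := y)) => //; apply: kn; try subset_tac;
  by rewrite cardsU1 ?xX ?yX card_X.
Qed.

Lemma known_compl K B D : spreading K -> known K B D -> k.+1 < #|D| ->
  known K (~: D) (~: B).
Proof.
move=> sprK kn lt_D U sDU sUB card_U; rewrite -[U]setCK; apply: sprK.1.
apply: known_lower kn lt_D _ _ _ => //; first by rewrite -setCS setCK.
  by rewrite -setCS setCK.
by have := cardsC_T U; card_lia.
Qed.

Lemma known_star K B D : #|B| = k -> (forall d, d \in D :\: B -> K (d |: B)) ->
  known K B D.
Proof.
move=> card_B K_star U sBU sUD card_U.
have /cards1P[d def_d] : #|U :\: B| == 1.
  by rewrite cardsD (setIidPr sBU) card_U card_B subSnn.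
have : d \in U :\: B by rewrite def_d inE.
rewrite !inE => /andP[dB dU].
rewrite (_ : U = d |: B); last by rewrite -def_d; seteq_tac.
by apply: K_star; rewrite inE dB (subsetP sUD).
Qed.

(** A k.+1-set that avoids y but contains B :\ y has at least two k-subsets that
    still contain B :\ y, so the lower layer alone has to be treated. *)
Lemma known_remove K B D y : spreading K -> #|B| <= k -> y \in B ->
  known K B D ->
  (forall X, B :\ y \subset X -> X \subset D :\ y -> #|X| = k -> K X) ->
  known K (B :\ y) D.
Proof.
move=> sprK le_B yB kn K_low U sBU sUD card_U; have card_B := cardsD1 y B.
rewrite yB in card_B.
case: (boolP (y \in U)) => yU; first by apply: kn => //; subset_tac.
have /exists_two[x [z []]] : 1 < #|U :\: (B :\ y)|.
  by apply: leq_trans (card_setD_ge _ _); card_lia.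
rewrite inE => /andP[xB xU]; rewrite inE => /andP[zB zU] neq_xz.
have := cardsD1 x U; have := cardsD1 z U; rewrite xU zU => cz cx.
apply: (sprK.2 _ x z) => //; apply: K_low; try card_lia; subset_tac.
Qed.

(** Deleting one element q of B costs only half of #|D| - k seeds. A new k-set X
    already has the active superset q |: X, hence it waits for a single further
    one, while a new k.+1-set waits for two of its subsets. Suppose everything is
    active over D without two elements f1 and f2. One seed f1 |: (f2 |: Z)
    activates f1 |: Z and f2 |: Z, and the exchange of one element of Z for another
    goes through a k.+1-set with two active subsets, one of which avoids f1 and f2.
    So a single seed pays for two elements of D. *)
Lemma removal_seeds c : forall D B q, q \in B -> B \subset D -> #|B| <= k ->
  #|D| <= k + 2 * c ->
  exists2 s : seq {set T}, size s <= c &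
    forall K, spreading K -> (forall X, X \in s -> K X) -> known K B D ->
    forall X, B :\ q \subset X -> X \subset D :\ q -> #|X| = k -> K X.
Proof.
elim: c => [|c IHc] D B q qB sBD le_B le_D.
  exists [::] => // K _ _ _ X _ sX card_X.
  have := subset_leq_card sX; have := cardsD1 q D; rewrite (subsetP sBD) //; card_lia.
have card_Dq := cardsD1 q D; rewrite (subsetP sBD) // in card_Dq.
have card_Bq := cardsD1 q B; rewrite qB in card_Bq.
case: (leqP #|D| k.+1) => [small_D|large_D].
  exists [:: D :\ q] => // K _ K_s _ X _ sX card_X.
  have -> : X = D :\ q by apply/eqP; rewrite eqEcard sX card_X; card_lia.
  by apply: K_s; rewrite inE.
have /exists_two[f1 [f2 []]] : 1 < #|D :\: B|.
  by apply: leq_trans (card_setD_ge _ _); card_lia.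
rewrite inE => /andP[f1B f1D]; rewrite inE => /andP[f2B f2D] neq_f.
pose D' := D :\ f1 :\ f2.
have card_D1 := cardsD1 f1 D; rewrite f1D in card_D1.
have card_D2 := cardsD1 f2 (D :\ f1); rewrite !inE eq_sym neq_f f2D /= in card_D2.
have sBD' : B \subset D' by rewrite /D'; subset_tac.
have [|s size_s K_s] := IHc D' B q qB sBD' le_B; first by rewrite /D'; card_lia.
have card_D'q := cardsD1 q D'; rewrite (subsetP sBD') // in card_D'q.
have sBD'q : B :\ q \subset D' :\ q by apply: setSD.
have [||Z [sBZ sZD card_Z]] := exists_subset_card (m := k.-1) sBD'q.
- by card_lia.
- by rewrite /D' in card_D'q *; card_lia.
have f1Z : f1 \notin Z by apply/negP => /(subsetP sZD); rewrite !inE eqxx !andbF.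
have f2Z : f2 \notin Z by apply/negP => /(subsetP sZD); rewrite !inE eqxx !andbF.
exists ((f1 |: (f2 |: Z)) :: s) => // K sprK K_seeds kn.
have {}K_s X : B :\ q \subset X -> X \subset D' :\ q -> #|X| = k -> K X.
  apply: K_s => // [Y sY|]; first by apply: K_seeds; rewrite inE sY orbT.
  by apply: known_sub kn => //; rewrite /D'; subset_tac.
have K_Z : K (f1 |: (f2 |: Z)) by apply: K_seeds; rewrite inE eqxx.
(* The superset q |: X contains B, so one more superset suffices. *)
have known_if_superset X z : B :\ q \subset X -> X \subset D :\ q -> #|X| = k ->
    z \notin X -> z != q -> K (z |: X) -> K X.
  move=> sBX sXD card_X zX zq Kz.
  have qX : q \notin X by apply/negP => /(subsetP sXD); rewrite !inE eqxx.
  apply: (spreading_down (x := z) (y := q)) => //.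
  apply: kn; [by subset_tac | | by rewrite cardsU1 qX card_X];
    by have qD := subsetP sBD q qB; subset_tac.
have K_Zf f : f \in [:: f1; f2] -> K (f |: Z).
  have := subsetP sBD' q qB; rewrite !inE => /and3P[q2 q1 qD] fF.
  have fZ : f \notin Z by move: fF => /orP[] /eqP ->.
  have [fD qf] : f \in D /\ q != f by case/orP: fF => /eqP ->.
  have [g [gZ gD gf qg K_fg]] : exists g,
      [/\ g \notin Z, g \in D, g != f, q != g & K (g |: (f |: Z))].
    case/orP: fF => /eqP ->; last by exists f1; split.
    by exists f2; split; rewrite // 1?eq_sym // setUCA.
  have sZD0 : Z \subset D :\ q by rewrite /D' in sZD; subset_tac.
  apply: (known_if_superset _ g) => //; [by subset_tac | by subset_tac | | | by rewrite eq_sym].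
    by rewrite cardsU1 fZ card_Z; card_lia.
  by rewrite !inE negb_or gf.
(* Exchange the elements of R outside Z one at a time. *)
have K_swap f : f \in [:: f1; f2] -> forall n R, #|R :\: Z| <= n ->
    B :\ q \subset R -> R \subset D' :\ q -> #|R| = k.-1 -> K (f |: R).
  move=> fF; have [fD fq fD'] : [/\ f \in D, f != q & f \notin D'].
    have := subsetP sBD' q qB; rewrite !inE ![q == _]eq_sym => /and3P[q2 q1 _].
    by move: fF; rewrite !inE => /orP[] /eqP ->; rewrite eqxx ?andbF.
  elim=> [|n IHn] R le_n sBR sRD card_R.
    rewrite (_ : R = Z); first exact: K_Zf.
    apply/eqP; rewrite eqEcard card_R card_Z leqnn andbT -setD_eq0 -cards_eq0.
    by rewrite -leqn0.
  have fR : f \notin R.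
    by apply: contra fD' => /(subsetP sRD); rewrite !inE => /andP[].
  case: (leqP #|R :\: Z| n) => [le_n'|gt_n]; first exact: IHn.
  have /card_gt0P[r] : 0 < #|R :\: Z| by card_lia.
  have /card_gt0P[r'] : 0 < #|Z :\: R|.
    by have := cardsID R Z; have := cardsID Z R; rewrite setIC; card_lia.
  rewrite inE => /andP[r'R r'Z]; rewrite inE => /andP[rZ rR].
  have r'D := subsetP sZD _ r'Z.
  have neq_r : r' != r by apply: contraNneq r'R => ->.
  have card_fR : #|f |: R| = k by rewrite cardsU1 fR card_R; card_lia.
  have r'f : r' != f by apply: contraNneq fD' => <-; move: r'D; rewrite inE => /andP[].
  have r'_all : [/\ r' != q, r' \in D & r' \in D'].
    by move: r'D; rewrite !inE => /and4P[-> -> -> ->].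
  case: r'_all => r'q r'D0 r'D'.
  have sRD0 : R \subset D :\ q by rewrite /D' in sRD; subset_tac.
  have rB : r \notin B :\ q by apply: contra rZ => /(subsetP sBZ).
  have rB' : (r != q) ==> (r \notin B) by move: rB; rewrite !inE; case: eqP.
  apply: (known_if_superset _ r') => //; [by subset_tac | by subset_tac | by rewrite !inE negb_or r'f | ].
  have r_f : r != f by apply: contraNneq fR => <-.
  have r'Rf : r' \notin f |: R by rewrite !inE negb_or r'f.
  apply: (sprK.2 _ r f) => //; rewrite ?inE ?eqxx ?rR ?orbT //.
  - by rewrite cardsU1 r'Rf card_fR.
  - rewrite (_ : _ :\ r = f |: (r' |: (R :\ r))); last by seteq_tac.
    have cR := cardsD1 r R; rewrite rR in cR.
    apply: IHn.
    + rewrite (_ : _ :\: Z = (R :\: Z) :\ r); last by seteq_tac.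
      by have := cardsD1 r (R :\: Z); rewrite inE rR rZ; card_lia.
    + by subset_tac.
    + by subset_tac.
    + by rewrite cardsU1 !inE (negPf r'R) andbF; card_lia.
  rewrite (_ : _ :\ f = r' |: R); last by seteq_tac.
  apply: K_s; [by subset_tac | by subset_tac | ].
  by rewrite cardsU1 r'R card_R; card_lia.
move=> X sBX sXD card_X.
have f1D' : f1 \notin D' :\ q by rewrite !inE eqxx !andbF.
have f2D' : f2 \notin D' :\ q by rewrite !inE eqxx !andbF.
have K_one f : f \in [:: f1; f2] -> forall R : {set T}, B :\ q \subset R ->
    R \subset D' :\ q -> #|R| = k.-1 -> K (f |: R).
  by move=> fF R; apply: (K_swap f fF _ R (leqnn _)).
have F1 : f1 \in [:: f1; f2] by rewrite inE eqxx.
have F2 : f2 \in [:: f1; f2] by rewrite !inE eqxx orbT.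
have k_gt0 : 0 < k by card_lia.
case: (boolP (f1 \in X)) => f1X; case: (boolP (f2 \in X)) => f2X.
- have cX1 := cardsD1 f1 X; have cX2 := cardsD1 f2 (X :\ f1).
  rewrite f1X in cX1; rewrite !inE f2X eq_sym neq_f /= in cX2.
  have /card_gt0P[r] : 0 < #|(D' :\ q) :\: (X :\ f1 :\ f2)|.
    by apply: leq_trans (card_setD_ge _ _); rewrite /D' in card_D'q *; card_lia.
  rewrite !inE => /andP[rX /and4P[rq r2 r1 rD]].
  rewrite r1 r2 /= in rX.
  have cR : #|r |: (X :\ f1 :\ f2)| = k.-1.
    by rewrite cardsU1 !inE (negPf rX) !andbF; card_lia.
  have sBR : B :\ q \subset r |: (X :\ f1 :\ f2) by subset_tac.
  have sRD : r |: (X :\ f1 :\ f2) \subset D' :\ q by rewrite /D'; subset_tac.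
  apply: (known_if_superset _ r) => //.
  apply: (sprK.2 _ f1 f2) => //; rewrite ?inE ?f1X ?f2X ?orbT //.
  + by rewrite cardsU1 rX card_X.
  + rewrite (_ : _ :\ f1 = f2 |: (r |: (X :\ f1 :\ f2))); last by seteq_tac.
    exact: K_one.
  + rewrite (_ : _ :\ f2 = f1 |: (r |: (X :\ f1 :\ f2))); last by seteq_tac.
    exact: K_one.
- rewrite -(setD1K f1X); apply: K_one => //; first by subset_tac.
    by rewrite /D'; subset_tac.
  by have := cardsD1 f1 X; rewrite f1X; card_lia.
- rewrite -(setD1K f2X); apply: K_one => //; first by subset_tac.
    by rewrite /D'; subset_tac.
  by have := cardsD1 f2 X; rewrite f2X; card_lia.
apply: K_s => //; by rewrite /D'; subset_tac.
Qed.

Lemma grow_seeds c D : #|D| <= k + 2 * c ->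
  forall b B B', B' \subset B -> B \subset D -> #|B| <= k -> #|B :\: B'| <= b ->
  exists2 s : seq {set T}, size s <= b * c &
    forall K, spreading K -> (forall X, X \in s -> K X) -> known K B D ->
    known K B' D.
Proof.
move=> le_D; elim=> [|b IHb] B B' sB'B sBD le_B le_b.
  exists [::] => // K _ _ kn; apply: known_sub kn => //.
  by rewrite -setD_eq0 -cards_eq0 -leqn0.
have [B_B'|[q]] := set_0Vmem (B :\: B').
  exists [::] => // K _ _ kn; apply: known_sub kn => //.
  by rewrite -setD_eq0 B_B'.
rewrite inE => /andP[qB' qB].
have cB := cardsD1 q B; rewrite qB in cB.
have [s1 size_s1 K_s1] := removal_seeds qB sBD le_B le_D.
have [||||s2 size_s2 K_s2] := IHb (B :\ q) B'.
- by subset_tac.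
- by subset_tac.
- by card_lia.
- rewrite (_ : _ :\: _ = (B :\: B') :\ q); last by seteq_tac.
  by have := cardsD1 q (B :\: B'); rewrite inE qB qB'; card_lia.
exists (s1 ++ s2); first by rewrite size_cat mulSn leq_add.
move=> K sprK K_s kn; apply: K_s2 => // [X Xs|].
  by apply: K_s; rewrite mem_cat Xs orbT.
apply: known_remove => //; apply: K_s1 => // X Xs.
by apply: K_s; rewrite mem_cat Xs.
Qed.

Section TwoCopies.
Variables (K : {set T} -> Prop) (P Q : {set T}) (a j : nat).
Hypotheses (sprK : spreading K) (def_k : k = j + a).
Hypotheses (card_P : #|P| = a) (card_Q : #|Q| = a) (dPQ : Q \subset ~: P).
Hypothesis known_Q : known K Q (~: P).

(** The first case of [spread_remove]: X does not meet P. The k-sets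
    between Q and ~: P are active; the elements of Q that X lacks are traded in
    one at a time. As #|B| <= j, enough elements of X lie outside B and Q to find
    two active subsets of q |: X. *)
Lemma spread_one_side B C y :
  #|B| <= j -> y \in B -> B \subset C -> C \subset ~: (P :|: Q) ->
  known K B (C :|: (P :|: Q)) ->
  forall X, B :\ y \subset X -> X \subset C :|: Q -> y \notin X -> #|X| = k -> K X.
Proof.
move=> le_B yB sBC sC kn X sBX sXC.
have cB := cardsD1 y B; rewrite yB in cB.
have [yC yPQ] : y \in C /\ y \notin P :|: Q.
  by have := subsetP sC y (subsetP sBC y yB); rewrite inE (subsetP sBC y yB).
have cP := cardsC_T P.
move: X sBX sXC; suff: forall n X, #|Q :\: X| <= n -> B :\ y \subset X ->
    X \subset C :|: Q -> y \notin X -> #|X| = k -> K X.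
  by move=> E X; apply: (E _ X (leqnn _)).
elim=> [|n IHn] X le_n sBX sXC yX card_X.
  have sQX : Q \subset X by rewrite -setD_eq0 -cards_eq0 -leqn0.
  apply: (known_lower sprK known_Q) => //; [by card_lia | ].
  by subset_tac.
have [Q_X|[q]] := set_0Vmem (Q :\: X); first by apply: IHn; rewrite ?Q_X ?cards0.
rewrite inE => /andP[qX qQ].
have cQ := cardsD1 q Q; rewrite qQ in cQ.
have qy : q != y by apply: contraNneq yPQ => <-; rewrite inE qQ orbT.
have qP : q \notin P by have := subsetP dPQ q qQ; rewrite inE.
have qB : q \notin C.
  by apply: contraL qQ => /(subsetP sC); rewrite !inE negb_or => /andP[].
have K_yX : K (y |: X).
  by apply: kn; [subset_tac | subset_tac | rewrite cardsU1 yX card_X].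
apply: (spreading_down (x := q) (y := y)) => //.
have /exists_two[x [z []]] : 1 < #|X :\: ((B :\ y) :|: (Q :\ q))|.
  apply: leq_trans (card_setD_ge _ _).
  have := cardsU (B :\ y) (Q :\ q); card_lia.
rewrite !inE !negb_or => /andP[/andP[xB xQ] xX] /andP[/andP[zB zQ] zX] neq_xz.
have qx : q != x by apply: contraNneq qX => ->.
have qz : q != z by apply: contraNneq qX => ->.
have K_sub v : v \in X -> q != v -> ~~ ((v != y) && (v \in B)) ->
    ~~ ((v != q) && (v \in Q)) -> K ((q |: X) :\ v).
  move=> vX qv vB vQ; rewrite (_ : _ :\ v = q |: (X :\ v)); last by seteq_tac.
  apply: IHn.
  - rewrite (_ : _ :\: _ = (Q :\: X) :\ q).
      by have := cardsD1 q (Q :\: X); rewrite inE qQ qX; card_lia.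
    have vQ' : v \notin Q by move: vQ; rewrite eq_sym qv.
    by seteq_tac.
  - by subset_tac.
  - by subset_tac.
  - by rewrite !inE negb_or eq_sym qy (negPf yX) andbF.
  - by have := cardsD1 v X; rewrite vX cardsU1 !inE (negPf qX) andbF; card_lia.
apply: (sprK.2 _ x z) => //; rewrite ?inE ?xX ?zX ?orbT //; try exact: K_sub.
by rewrite cardsU1 qX card_X.
Qed.

End TwoCopies.

Section Spread.
Variables (K : {set T} -> Prop) (P Q : {set T}) (a j : nat).
Hypotheses (sprK : spreading K) (def_k : k = j + a).
Hypotheses (card_P : #|P| = a) (card_Q : #|Q| = a) (dPQ : Q \subset ~: P).
Hypothesis known_Q : known K Q (~: P).

(** Once the antipodal intervals [Q, ~: P] and [P, ~: Q] are active, a third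
    interval that contains P and Q in its free part grows without any seed. A new
    k-set X that meets both P and Q, say in p and q, is covered by z |: X for some
    z in C (this is where k <= #|C| enters), and this set has the two subsets
    without p and without q, which have a smaller trace on P and Q. *)
Lemma spread_remove B C y :
  #|B| <= j -> y \in B -> B \subset C -> C \subset ~: (P :|: Q) -> k <= #|C| ->
  known K B (C :|: (P :|: Q)) -> known K (B :\ y) (C :|: (P :|: Q)).
Proof.
move=> le_B yB sBC sC le_C kn; apply: known_remove => // [|X]; first by card_lia.
have cB := cardsD1 y B; rewrite yB in cB.
have known_P : known K P (~: Q).
  rewrite -[P]setCK; apply: known_compl => //.
  by have := cardsC_T P; card_lia.
have dQP : P \subset ~: Q by rewrite -[P]setCK setCS.
have [yC yPQ] : y \in C /\ y \notin P :|: Q.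
  by have := subsetP sC y (subsetP sBC y yB); rewrite inE (subsetP sBC y yB).
move: X; suff: forall n X, #|X :&: (P :|: Q)| <= n -> B :\ y \subset X ->
    X \subset (C :|: (P :|: Q)) :\ y -> #|X| = k -> K X.
  by move=> E X; apply: (E _ X (leqnn _)).
elim=> [|n IHn] X le_n sBX sXD card_X.
  have yX : y \notin X by apply/negP => /(subsetP sXD); rewrite !inE eqxx.
  apply: (spread_one_side sprK def_k card_P card_Q dPQ known_Q le_B yB sBC sC kn) => //.
  have /eqP X_PQ : X :&: (P :|: Q) == set0 by rewrite -cards_eq0 -leqn0.
  have sX : X \subset ~: (P :|: Q) by rewrite -disjoints_subset -setI_eq0 X_PQ.
  by subset_tac.
have yX : y \notin X by apply/negP => /(subsetP sXD); rewrite !inE eqxx.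
have [X_P|[p]] := set_0Vmem (X :&: P).
  have sX : X \subset ~: P by rewrite -disjoints_subset -setI_eq0 X_P.
  apply: (spread_one_side sprK def_k card_P card_Q dPQ known_Q le_B yB sBC sC kn) => //.
  by subset_tac.
have [X_Q|[q]] := set_0Vmem (X :&: Q).
  have sX : X \subset ~: Q by rewrite -disjoints_subset -setI_eq0 X_Q.
  move=> _; have sC' := sC; have kn' := kn.
  rewrite setUC in sC'; rewrite [P :|: Q]setUC in kn'.
  apply: (spread_one_side sprK def_k card_Q card_P dQP known_P le_B yB sBC sC' kn') => //.
  by subset_tac.
rewrite !inE => /andP[qX qQ] /andP[pX pP].
have neq_pq : p != q.
  by apply: contraL qQ => /eqP <-; have := subsetP dQP p pP; rewrite inE.
have cX1 := cardsD1 p X; have cX2 := cardsD1 q (X :\ p).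
rewrite pX in cX1; rewrite !inE qX eq_sym neq_pq /= in cX2.
have /card_gt0P[z] : 0 < #|C :\: (y |: (X :\ p :\ q))|.
  apply: leq_trans (card_setD_ge _ _); rewrite cardsU1.
  by case: (y \notin _) => /=; card_lia.
rewrite inE => /andP[zX zC].
have := subsetP sC z zC; rewrite !inE negb_or => /andP[zP zQ].
have zp : z != p by apply: contraNneq zP => ->.
have zq : z != q by apply: contraNneq zQ => ->.
have [zy {}zX] : z != y /\ z \notin X.
  by move: zX; rewrite !inE zp zq negb_or => /andP[].
have yp : y != p by apply: contraNneq yX => ->.
have yq : y != q by apply: contraNneq yX => ->.
have K_yX : K (y |: X).
  by apply: kn; [subset_tac | subset_tac | rewrite cardsU1 yX card_X].
apply: (spreading_down (x := z) (y := y)) => //.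
have K_sub v : v \in X -> v \in P :|: Q -> z != v -> y != v -> K ((z |: X) :\ v).
  move=> vX vPQ zv yv.
  have vC : v \notin C.
    by apply: contraL vPQ => /(subsetP sC); rewrite inE.
  apply: IHn.
  - rewrite (_ : _ :&: _ = (X :&: (P :|: Q)) :\ v); last by seteq_tac.
    by have := cardsD1 v (X :&: (P :|: Q)); rewrite in_setI vX vPQ; card_lia.
  - by subset_tac.
  - by subset_tac.
  - by have := cardsD1 v (z |: X); rewrite cardsU1 zX !inE vX orbT; card_lia.
apply: (sprK.2 _ p q) => //; rewrite ?inE ?pX ?qX ?orbT //.
- by rewrite cardsU1 zX card_X.
- by apply: K_sub; rewrite ?inE ?pP.
- by apply: K_sub; rewrite ?inE ?qQ ?orbT.
Qed.

Lemma spread_all B C : #|B| <= j -> B \subset C -> C \subset ~: (P :|: Q) ->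
  k <= #|C| -> known K B (C :|: (P :|: Q)) -> known K set0 (C :|: (P :|: Q)).
Proof.
have [n] : exists n, #|B| <= n by exists #|B|.
elim: n B => [|n IHn] B le_n le_B sBC sC le_C kn.
  by move: le_n kn; rewrite leqn0 cards_eq0 => /eqP ->.
have [B0|[y yB]] := set_0Vmem B; first by rewrite B0 in kn.
have cB := cardsD1 y B; rewrite yB in cB.
apply: (IHn (B :\ y) _ _ _ sC le_C); [by card_lia | by card_lia | by subset_tac | ].
exact: spread_remove.
Qed.
End Spread.

(** Take disjoint a-sets P and Q, a k-set C in the rest, and a j-subset Y of C.
    Starting from the k-set Y :|: Q, the interval [Q, ~: P] is activated by the
    j.+1 sets just above and j deletions, and then [Y, C :|: P :|: Q] by a
    further sets just above and a deletions. The rest is free: [spread_all] reaches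
    [set0, C :|: P :|: Q], complementation turns it into an interval whose top is
    the whole ground set, and [spread_all] brings its bottom down to set0. *)
Lemma spreading_seeds a j : 0 < a -> k = j + a -> a <= j.+1 ->
  exists2 s : seq {set T}, size s <= j.+1 + j * (j.+2)./2 + (a + a * a) &
    forall K, spreading K -> (forall X, X \in s -> K X) ->
    forall X, #|X| = k -> K X.
Proof.
move=> a_gt0 def_k le_a.
have [||P [_ _ card_P]] := exists_subset_card (m := a) (sub0set [set: T]).
- by rewrite cards0.
- by rewrite cardsT card_T; card_lia.
have cP := cardsC_T P.
have [||Q [_ dPQ card_Q]] := exists_subset_card (m := a) (sub0set (~: P)).
- by rewrite cards0.
- by card_lia.
have cPQ : #|P :|: Q| = 2 * a.
  rewrite cardsU (_ : P :&: Q = set0) ?cards0 ?subn0 ?card_P ?card_Q; first card_lia.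
  by seteq_tac.
have cE := cardsC_T (P :|: Q).
have [||C [_ sC card_C]] := exists_subset_card (m := k) (sub0set (~: (P :|: Q))).
- by rewrite cards0.
- by card_lia.
have [||Y [_ sYC card_Y]] := exists_subset_card (m := j) (sub0set C).
- by rewrite cards0.
- by card_lia.
have cYQ : #|Y :|: Q| = k.
  rewrite cardsU (_ : Y :&: Q = set0) ?cards0 ?subn0 ?card_Y ?card_Q //.
  by seteq_tac.
have cYQY : #|(Y :|: Q) :\: Y| <= a.
  by rewrite -card_Q subset_leq_card //; subset_tac.
have cYQQ : #|(Y :|: Q) :\: Q| <= j.
  by rewrite -card_Y subset_leq_card //; subset_tac.
have [|||||s2 size_s2 K_s2] := @grow_seeds (j.+2)./2 (~: P) _ j (Y :|: Q) Q.
- by card_lia.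
- exact: subsetUr.
- by subset_tac.
- by rewrite cYQ.
- exact: cYQQ.
have [|||||s4 size_s4 K_s4] := @grow_seeds a (C :|: (P :|: Q)) _ a (Y :|: Q) Y.
- by rewrite cardsU cPQ card_C; card_lia.
- exact: subsetUl.
- by subset_tac.
- by rewrite cYQ.
- exact: cYQY.
pose s1 := [seq e |: (Y :|: Q) | e <- enum (~: (P :|: Q) :\: Y)].
pose s3 := [seq p |: (Y :|: Q) | p <- enum P].
have sYE : Y \subset ~: (P :|: Q) := subset_trans sYC sC.
have size_s1 : size s1 = j.+1.
  by rewrite size_map -cardE cardsD (setIidPr sYE); card_lia.
have size_s3 : size s3 = a by rewrite size_map -cardE.
exists ((s1 ++ s2) ++ (s3 ++ s4)).
  by rewrite !size_cat size_s1 size_s3 leq_add // ?leq_add2l.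
move=> K sprK K_s.
have known_Q : known K Q (~: P).
  apply: K_s2 => // [X Xs|]; first by apply: K_s; rewrite !mem_cat Xs !orbT.
  apply: known_star => // d dD; apply: K_s; rewrite !mem_cat; apply/orP; left.
  apply/orP; left; apply/mapP; exists d => //; rewrite mem_enum.
  by move: dD; rewrite !inE !negb_or => /andP[/andP[-> ->] ->].
have known_Y : known K Y (C :|: (P :|: Q)).
  apply: K_s4 => // [X Xs|]; first by apply: K_s; rewrite !mem_cat Xs !orbT.
  apply: known_star => // d dD; case: (boolP (d \in P)) => dP.
    apply: K_s; rewrite !mem_cat; apply/orP; right; apply/orP; left.
    by apply/mapP; exists d => //; rewrite mem_enum.
  have sPQ : P \subset ~: Q by rewrite -[P]setCK setCS.
  apply: known_Q; [by subset_tac | by subset_tac | ].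
  by move: dD; rewrite inE => /andP[dYQ _]; rewrite cardsU1 dYQ cYQ.
have le_Y : #|Y| <= j by rewrite card_Y.
have le_C : k <= #|C| by rewrite card_C.
have {known_Y} known_D :=
  spread_all sprK def_k card_P card_Q dPQ known_Q le_Y sYC sC le_C known_Y.
have cD : #|C :|: (P :|: Q)| = k + 2 * a.
  rewrite cardsU (_ : C :&: (P :|: Q) = set0) ?cards0 ?subn0 ?card_C ?cPQ //.
  by seteq_tac.
have known_G : known K (~: (C :|: (P :|: Q))) (~: (P :|: Q) :|: (P :|: Q)).
  rewrite (_ : ~: (P :|: Q) :|: (P :|: Q) = ~: set0); last by seteq_tac.
  by apply: known_compl => //; rewrite cD; card_lia.
have known_T := spread_all sprK def_k card_P card_Q dPQ known_Q _ _ _ _ known_G.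
have cG := cardsC_T (C :|: (P :|: Q)).
move=> X card_X; apply: (known_lower sprK (known_T _ _ _ _)) => //.
- by card_lia.
- by subset_tac.
- by card_lia.
- rewrite (_ : _ :|: (P :|: Q) = [set: T]); last by seteq_tac.
  by rewrite cardsT card_T; card_lia.
- exact: sub0set.
- by subset_tac.
Qed.

End OddUpper.

(** A seed of any size is harmless: it stands for the vertices that are equal to it
    or to its complement, and there is at most one of those. *)
Lemma min_percolating_seeds k (s : seq {set 'I_(2 * k + 1)}) :
  (forall K : {set 'I_(2 * k + 1)} -> Prop, spreading k K ->
     (forall X : {set _}, X \in s -> K X) -> forall X : {set _}, #|X| = k -> K X) ->
  min_percolating (@odd_adj k) 2 <= size s.
Proof.
move=> s_spreads; pose A := [set v : odd_vertex k | (val v \in s) || (~: val v \in s)].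
have card_v (v : odd_vertex k) : #|val v| = k := eqP (valP v).
have card_Cv (v : odd_vertex k) : #|~: val v| = k.+1.
  by have := cardsC (val v); rewrite card_ord card_v; card_lia.
apply: (@leq_trans #|A|); last first.
  pose f (v : odd_vertex k) := if val v \in s then val v else ~: val v.
  rewrite cardE -(size_map f); apply: uniq_leq_size.
    rewrite map_inj_uniq ?enum_uniq // => v w; rewrite /f.
    have neq (v1 v2 : odd_vertex k) : val v1 <> ~: val v2.
      by move=> E; have := card_v v1; rewrite E card_Cv; card_lia.
    case: ifP => _; case: ifP => _ E; first exact: val_inj.
    + by case: (neq _ _ E).
    + by case: (neq _ _ (esym E)).
    + exact/val_inj/setC_inj.
  move=> X /mapP[v]; rewrite mem_enum inE /f => + ->.
  by case: ifP.
apply: min_percolating_le; exists #|odd_vertex k|.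
set cl := bootstrap _ _ _ _.
have clT : bootstrap_step (@odd_adj k) 2 cl \subset cl.
  have [full|] := bootstrap_stable (@odd_adj k) 2 A #|odd_vertex k|.
    rewrite (_ : cl = [set: _]) ?subsetT //.
    by apply/eqP; rewrite eqEcard subsetT cardsT.
  by rewrite {1}/bootstrap iterS -/(bootstrap _ _ _ _) => ->.
pose K X := forall v : odd_vertex k, (val v = X) \/ (val v = ~: X) -> v \in cl.
have sprK : spreading k K.
  split=> [X KX v|U x y card_U xU yU neq_xy Kx Ky v].
    by rewrite setCK => E; apply: KX; case: E; [right | left].
  case=> def_v; first by have := card_v v; rewrite def_v card_U; card_lia.
  have nbr z : z \in U -> K (U :\ z) -> exists u : odd_vertex k,
      [/\ u \in cl, odd_adj v u & val u = U :\ z].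
    move=> zU Kz; have card_z : #|U :\ z| == k.
      by have := cardsD1 z U; rewrite zU card_U add1n => /eq_add_S <-.
    exists (Sub (U :\ z) card_z); split=> //; first by apply: Kz; left.
    by rewrite /odd_adj def_v /= disjoint_sym disjoints_subset setCK subD1set.
  have [u1 [cl1 adj1 val1]] := nbr x xU Kx.
  have [u2 [cl2 adj2 val2]] := nbr y yU Ky.
  apply: (subsetP clT); rewrite !inE; apply/orP; right.
  apply/card_gt1P; exists u1, u2; split; rewrite ?inE ?cl1 ?cl2 //.
  apply: contra_neq neq_xy => eq_u; apply/eqP; apply: contraT => neq_xy.
  have : x \in U :\ x by rewrite -val1 eq_u val2 !inE neq_xy.
  by rewrite !inE eqxx.
apply/eqP; rewrite -subTset; apply/subsetP => v _.
apply: (s_spreads K sprK) (card_v v) _ (or_introl erefl) => X Xs u def_u.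
apply: (subsetP (bootstrap_sub (@odd_adj k) 2 A (leq0n _))).
by rewrite inE; case: def_u => ->; rewrite ?setCK Xs ?orbT.
Qed.

Lemma min_percolating_upper k : 0 < k ->
  3 * min_percolating (@odd_adj k) 2 <= k ^ 2 + 5 * k + 3.
Proof.
(* The two copies cost about (k - a)^2 / 2 and the third interval about a^2;
   the sum is smallest at a = k / 3. *)
move=> k_gt0; pose a := (k + 2) %/ 3; pose j := k - a.
have [|||s size_s K_s] := @spreading_seeds 'I_(2 * k + 1) k (card_ord _) a j.
- by rewrite /a; lia.
- by rewrite /j /a; lia.
- by rewrite /j /a; lia.
have := leq_trans (min_percolating_seeds K_s) size_s.
move: (min_percolating _ _) => m le_m.
suff: 3 * (j.+1 + j * (j.+2)./2 + (a + a * a)) <= k ^ 2 + 5 * k + 3 by lia.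
have [n def_ka] : exists n, k = 3 * n /\ a = n \/
    k = 3 * n + 1 /\ a = n.+1 \/ k = 3 * n + 2 /\ a = n.+1.
  by exists (k %/ 3); rewrite /a; lia.
case: def_ka => [[def_k def_a]|[[def_k def_a]|[def_k def_a]]].
- have [-> ->] : j = 2 * n /\ (2 * n).+2./2 = n.+1 by rewrite /j; lia.
  by rewrite def_a def_k; nia.
- have [-> ->] : j = 2 * n /\ (2 * n).+2./2 = n.+1 by rewrite /j; lia.
  by rewrite def_a def_k; nia.
have [-> ->] : j = 2 * n + 1 /\ (2 * n + 1).+2./2 = n.+1 by rewrite /j; lia.
by rewrite def_a def_k; nia.
Qed.

Local Open Scope ring_scope.

(** * Alternating forms on polynomials *)

Definition alternating (F : numFieldType) (w : {poly F} -> {poly F} -> F) : Prop :=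
  (forall c f g h, w (c *: f + g) h = c * w f h + w g h) /\
  (forall f g, w f g = - w g f).

Section Alternating.
Variables (F : numFieldType) (w : {poly F} -> {poly F} -> F).
Hypothesis w_alt : alternating w.

Lemma alt0l g : w 0 g = 0.
Proof.
have := w_alt.1 1 0 0 g; rewrite scaler0 addr0 mul1r => /eqP.
by rewrite -subr_eq0 opprD addNKr oppr_eq0 => /eqP.
Qed.

Lemma altDl f g h : w (f + g) h = w f h + w g h.
Proof. by have := w_alt.1 1 f g h; rewrite scale1r mul1r. Qed.

Lemma altZl c f h : w (c *: f) h = c * w f h.
Proof. by have := w_alt.1 c f 0 h; rewrite alt0l !addr0. Qed.

Lemma altBl f g h : w (f - g) h = w f h - w g h.
Proof. by rewrite altDl -scaleN1r altZl mulN1r. Qed.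

Lemma altDr f g h : w h (f + g) = w h f + w h g.
Proof. by rewrite w_alt.2 altDl opprD -!w_alt.2. Qed.

Lemma altZr c f h : w h (c *: f) = c * w h f.
Proof. by rewrite w_alt.2 altZl -mulrN -w_alt.2. Qed.

Lemma altBr f g h : w h (f - g) = w h f - w h g.
Proof. by rewrite altDr -scaleN1r altZr mulN1r. Qed.

Lemma alt_diag f : w f f = 0.
Proof. by apply/eqP; rewrite -eqNr -w_alt.2. Qed.

Lemma mulXsubC (c : F) (f : {poly F}) : ('X - c%:P) * f = 'X * f - c *: f.
Proof. by rewrite mulrBl mul_polyC. Qed.

Lemma alt_mulXsubC p q f g :
  w (('X - p%:P) * f) (('X - q%:P) * g) =
  w ('X * f) ('X * g) - q * w ('X * f) g - p * w f ('X * g) + p * q * w f g.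
Proof. rewrite !mulXsubC !(altBl, altBr, altZl, altZr); ring. Qed.

Lemma alt_common_factor p q f :
  w (('X - p%:P) * f) (('X - q%:P) * f) = (p - q) * w ('X * f) f.
Proof.
rewrite alt_mulXsubC !alt_diag (w_alt.2 f); ring.
Qed.

(** The form that drives the induction of [alternating_eq0]: the symmetrization in
    p and q is what makes it alternating again. *)
Lemma alternating_twist p q : alternating (fun f g =>
  w (('X - p%:P) * f) (('X - q%:P) * g) + w (('X - q%:P) * f) (('X - p%:P) * g)).
Proof.
split=> [c f g h|f g]; last first.
  by rewrite opprD addrC; congr (_ + _); rewrite w_alt.2.
by rewrite !mulrDr -!scalerAr !altDl !altZl; ring.
Qed.

End Alternating.

Definition roots_prod (F : nzRingType) (I : Type) (x : I -> F) (s : seq I) :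
  {poly F} := \prod_(i <- s) ('X - (x i)%:P).

Lemma perm_cons_cat_cons (I : eqType) (p q u : I) (S T r s : seq I) :
  perm_eq (u :: S ++ T) r -> perm_eq [:: p, q & r] s ->
  perm_eq (u :: (p :: S) ++ q :: T) s.
Proof.
move=> /permP perm_r /permP perm_s; apply/permP => P.
by move: (perm_r P) (perm_s P); rewrite /= !count_cat /=; lia.
Qed.

(** An alternating form on the polynomials of degree at most k.+2 is zero as soon as
    it vanishes on the edge vectors. For two elements p and q of s the twisted form
      w ((X - p) f) ((X - q) g) + w ((X - q) f) ((X - p) g)
    satisfies the hypothesis for s without p and q, so it vanishes in degree at
    most k.+1. Comparing three such pairs separates the coefficients of 1, p + q
    and p q, which are the values of w on neighbouring monomials. For three nodes
    the claim is the Vandermonde determinant. *)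
Lemma alternating_eq0 (F : numFieldType) (I : eqType) (x : I -> F) (k : nat)
    (s : seq I) (w : {poly F} -> {poly F} -> F) :
  injective x -> uniq s -> size s = (2 * k.+1 + 1)%N -> alternating w ->
  (forall u S T, perm_eq (u :: S ++ T) s -> size S = k.+1 -> size T = k.+1 ->
     w (roots_prod x (u :: S)) (roots_prod x (u :: T)) = 0) ->
  forall i j, (i <= k.+2)%N -> (j <= k.+2)%N -> w 'X^i 'X^j = 0.
Proof.
move=> x_inj; elim: k s w => [|k IHk] s w s_uniq s_size w_alt w_edge.
  case: s s_uniq s_size w_edge => [|a [|b [|c [|]]]] //= /and3P[].
  rewrite !inE negb_or => /andP[ab ac] bc _ _ w_edge.
  have edge u v t : perm_eq [:: u; v; t] [:: a; b; c] -> v != t ->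
      w 'X^2 'X - x u * w 'X^2 1 + x u ^+ 2 * w 'X 1 = 0.
    move=> perm_uvt neq_vt; have := w_edge u [:: v] [:: t] perm_uvt erefl erefl.
    rewrite /roots_prod !big_cons !big_nil !mulr1 !(mulrC ('X - (x u)%:P)).
    rewrite (alt_common_factor w_alt) => /eqP.
    rewrite mulf_eq0 subr_eq0 (inj_eq x_inj) (negPf neq_vt) /= => /eqP <-.
    have -> : 'X * ('X - (x u)%:P) = 'X^2 - x u *: 'X.
      by rewrite mulrBr -expr2 ['X * _%:P]mulrC mul_polyC.
    rewrite -alg_polyC !(altBl w_alt, altBr w_alt, altZl w_alt, altZr w_alt).
    by rewrite (alt_diag w_alt); ring.
  have eqa : w 'X^2 'X - x a * w 'X^2 1 + x a ^+ 2 * w 'X 1 = 0 by exact: edge bc.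
  have eqb : w 'X^2 'X - x b * w 'X^2 1 + x b ^+ 2 * w 'X 1 = 0.
    by apply: edge ac; apply/permP => P /=; lia.
  have eqc : w 'X^2 'X - x c * w 'X^2 1 + x c ^+ 2 * w 'X 1 = 0.
    by apply: edge ab; apply/permP => P /=; lia.
  have [xab xac xbc] : [/\ x a - x b != 0, x a - x c != 0 & x b - x c != 0].
    by rewrite !subr_eq0 !(inj_eq x_inj).
  have e20 : w 'X^2 1 = (x a + x b) * w 'X 1.
    apply/eqP; rewrite -subr_eq0; apply/eqP/(mulfI xab).
    by rewrite mulr0 -[RHS](subrr 0) -{1}eqb -eqa; ring.
  have e10 : w 'X 1 = 0.
    apply/(mulfI xac)/(mulfI xbc); rewrite e20 in eqa eqc.
    by rewrite !mulr0 -[RHS](subrr 0) -{1}eqc -eqa; ring.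
  have e21 : w 'X^2 'X = 0 by move: eqa; rewrite e20 e10 !mulr0 subr0 addr0.
  rewrite e10 mulr0 in e20.
  case=> [|[|[|//]]] [|[|[|//]]] _ _;
    rewrite ?expr0 ?expr1 ?(alt_diag w_alt) // ?e10 ?e20 ?e21 //;
    by rewrite (w_alt.2) ?e10 ?e20 ?e21 oppr0.
case: s s_uniq s_size w_edge => [|a [|b [|c s]]] //=; try lia.
rewrite !inE !negb_or => /and4P[/and3P[ab ac a_s] /andP[bc b_s] c_s s_uniq].
move=> s_size w_edge.
have [xab xac xbc] : [/\ x a - x b != 0, x a - x c != 0 & x b - x c != 0].
  by rewrite !subr_eq0 !(inj_eq x_inj).
have twist p q r : perm_eq [:: p; q; r] [:: a; b; c] -> r \notin s ->
    forall i j, (i <= k.+2)%N -> (j <= k.+2)%N ->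
    2 * w 'X^(i.+1) 'X^(j.+1) + 2 * x p * x q * w 'X^i 'X^j =
    (x p + x q) * (w 'X^(i.+1) 'X^j + w 'X^i 'X^(j.+1)).
  move=> perm_pqr r_s i j le_i le_j.
  have := IHk (r :: s) _ _ _ (alternating_twist w_alt (x p) (x q)) _ i j le_i le_j.
  rewrite /= r_s s_uniq => /(_ erefl) E; apply/eqP; rewrite -subr_eq0; apply/eqP.
  rewrite -[RHS]E; first by rewrite !(alt_mulXsubC w_alt) -!exprS; ring.
    by clear -s_size; lia.
  move=> u S T perm_uST size_S size_T.
  have roots_cons v V : ('X - (x v)%:P) * roots_prod x (u :: V) =
      roots_prod x (u :: v :: V).
    by rewrite /roots_prod !big_cons mulrCA.
  have perm_cons v v' : perm_eq [:: v; v'; r] [:: a; b; c] ->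
      perm_eq (u :: (v :: S) ++ v' :: T) [:: a, b, c & s].
    move=> perm_vv'; apply: perm_cons_cat_cons perm_uST _.
    by rewrite -[X in perm_eq X _]/([:: v; v'; r] ++ s)
         -[X in perm_eq _ X]/([:: a; b; c] ++ s) perm_cat2r.
  rewrite !roots_cons !w_edge /= ?size_S ?size_T ?addr0 //; apply: perm_cons => //.
  by rewrite -(permPr perm_pqr) (perm_catCA [:: q] [:: p] [:: r]).
have perm_acb : perm_eq [:: a; c; b] [:: a; b; c].
  by rewrite perm_cons (perm_catC [:: c] [:: b]).
have perm_bca : perm_eq [:: b; c; a] [:: a; b; c].
  by rewrite (perm_catC [:: b; c] [:: a]).
have solve i j : (i <= k.+2)%N -> (j <= k.+2)%N ->
    [/\ w 'X^i 'X^j = 0, w 'X^(i.+1) 'X^j + w 'X^i 'X^(j.+1) = 0 &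
        w 'X^(i.+1) 'X^(j.+1) = 0].
  move=> le_i le_j.
  have E1 := twist a b c (perm_refl _) c_s i j le_i le_j.
  have E2 : 2 * _ + _ = _ := twist a c b perm_acb b_s i j le_i le_j.
  have E3 : 2 * _ + _ = _ := twist b c a perm_bca a_s i j le_i le_j.
  move: E1 E2 E3; set Z := w 'X^(i.+1) 'X^(j.+1); set X := w 'X^i 'X^j.
  set Y := w _ _ + w _ _ => E1 E2 E3.
  have neq2 : (2 : F) != 0 by rewrite pnatr_eq0.
  have eqY : Y = 2 * x a * X.
    apply/eqP; rewrite -subr_eq0; apply/eqP/(mulfI xbc).
    have/eqP := E1; have/eqP := E2; rewrite -subr_eq0 => /eqP D2.
    by rewrite -subr_eq0 => /eqP D1; rewrite mulr0 -[RHS](subrr 0) -{1}D2 -D1; ring.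
  have X0 : X = 0.
    apply/(mulfI xab)/(mulfI xac)/(mulfI neq2); rewrite eqY in E1 E3.
    have/eqP := E1; have/eqP := E3; rewrite -subr_eq0 => /eqP D3.
    by rewrite -subr_eq0 => /eqP D1; rewrite !mulr0 -[RHS](subrr 0) -{1}D3 -D1; ring.
  have Y0 : Y = 0 by rewrite eqY X0 mulr0.
  by split=> //; apply/(mulfI neq2); move: E1; rewrite X0 Y0 !mulr0 addr0.
move=> [|i] [|j] le_i le_j; first by case: (solve 0 0)%N.
- case: (ltnP j k.+2) => [lt_j|ge_j]; first by case: (solve 0 j.+1)%N.
  have -> : j = k.+2 by apply/eqP; rewrite eqn_leq ge_j andbT.
  case: (solve 0 k.+2)%N => // _ + _.
  by case: (solve 0 k.+1)%N => // _ _ ->; rewrite add0r.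
- case: (ltnP i k.+2) => [lt_i|ge_i]; first by case: (solve i.+1 0)%N.
  have -> : i = k.+2 by apply/eqP; rewrite eqn_leq ge_i andbT.
  case: (solve k.+2 0)%N => // _ + _.
  by case: (solve k.+1 0)%N => // _ _ ->; rewrite addr0.
- by case: (solve i j).
Qed.

(** * Forms that vanish on edges *)

Lemma card_ltn_pairs n : #|[pred p : 'I_n * 'I_n | (p.1 < p.2)%N]| = 'C(n, 2).
Proof.
rewrite -sum1_card (eq_bigl (fun p : 'I_n * 'I_n => true && (p.1 < p.2)%N)) //.
rewrite -bin2_sum big_mkord.
rewrite -(pair_big_dep xpredT (fun i j : 'I_n => (i < j)%N) (fun _ _ => 1%N)) /=.
rewrite (exchange_big_dep xpredT) //=; apply: eq_bigr => j _.
rewrite sum1_card -[RHS]card_ord -(card_image (f := widen_ord (ltnW (ltn_ord j)))).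
  apply: eq_card => i; rewrite unfold_in /=; apply/idP/imageP => [lt_ij|[i' _ ->]] /=.
    by exists (Ordinal lt_ij) => //; apply: val_inj.
  exact: ltn_ord.
by move=> i1 i2 /(congr1 val) /= /val_inj.
Qed.

(** The alternating forms on polynomials of degree less than n have dimension
    'C(n, 2), so fewer linear conditions leave a nonzero one. *)
Lemma exists_alternating (F : numFieldType) (n m : nat)
    (f g : 'I_m -> {poly F}) : (m < 'C(n, 2))%N ->
  exists w : {poly F} -> {poly F} -> F,
    [/\ alternating w, forall c, w (f c) (g c) = 0 &
        ~ forall i j, (i < n)%N -> (j < n)%N -> w 'X^i 'X^j = 0].
Proof.
rewrite -card_ltn_pairs; set P := [pred p : 'I_n * 'I_n | _] => lt_m.
pose ev (t : 'I_n * 'I_n) (a b : {poly F}) := a`_(t.1) * b`_(t.2) - a`_(t.2) * b`_(t.1).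
pose M : 'M[F]_(#|P|, m) := \matrix_(t, c) ev (enum_val t) (f c) (g c).
have /rowV0Pn[u /sub_kermxP uM u_neq0] : kermx M != 0.
  by rewrite -mxrank_eq0 mxrank_ker subn_eq0 -ltnNge (leq_ltn_trans (rank_leq_col M)).
exists (fun a b => \sum_t u 0 t * ev (enum_val t) a b); split.
- split=> [c a b d|a b]; last first.
    by rewrite -sumrN; apply: eq_bigr => t _; rewrite /ev; ring.
  rewrite mulr_sumr -big_split; apply: eq_bigr => t _ /=.
  by rewrite /ev !coefD !coefZ; ring.
- move=> c; have /matrixP/(_ 0 c) := uM; rewrite !mxE => E; rewrite -[RHS]E.
  by apply: eq_bigr => t _; rewrite mxE.
move=> w0; case/eqP: u_neq0; apply/rowP => t; rewrite mxE.
have /= lt_t : P (enum_val t) := enum_valP t.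
have := w0 _ _ (ltn_ord (enum_val t).1) (ltn_ord (enum_val t).2).
rewrite (bigD1 t) //= big1 ?addr0 => [|s neq_st]; last first.
  have /= lt_s : P (enum_val s) := enum_valP s.
  have neq : enum_val s != enum_val t by rewrite (inj_eq enum_val_inj).
  move: neq lt_s lt_t; rewrite /ev !coefXn.
  case: (enum_val s) (enum_val t) => [i1 j1] [i2 j2] /=.
  rewrite xpair_eqE -!(inj_eq val_inj) /= -!natrM !mulnb => /negPf ->.
  case: andP => [[/eqP E1 /eqP E2]|_ _ _]; last by rewrite subrr mulr0.
  by clear -E1 E2; lia.
rewrite /ev !coefXn !eqxx (gtn_eqF lt_t) mul0r subr0 !mulr1; exact.
Qed.

Section OddLower.
Variable k : nat.
Local Notation V := (odd_vertex k).
Variables (F : numFieldType) (w : {poly F} -> {poly F} -> F).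
Hypothesis w_alt : alternating w.

Definition node (i : 'I_(2 * k + 1)) : F := (val i)%:R.

Lemma node_inj : injective node.
Proof. by move=> i j /eqP; rewrite eqr_nat => /eqP /val_inj. Qed.

Definition set_poly (S : {set 'I_(2 * k + 1)}) : {poly F} :=
  \prod_(i in S) ('X - (node i)%:P).

(** The two conditions say that w vanishes on all edge vectors at S: the neighbour
    reached through the third block u has the edge vector given by
    (X - u) P_S and P_(~: S), and this is affine in u. *)
Definition dead (S : V) : Prop :=
  w (set_poly (val S)) (set_poly (~: val S)) = 0 /\
  w ('X * set_poly (val S)) (set_poly (~: val S)) = 0.

Lemma set_polyU1 u (S : {set _}) : u \notin S ->
  set_poly (u |: S) = ('X - (node u)%:P) * set_poly S.
Proof. exact: big_setU1. Qed.

(** An edge of the odd graph is a partition of the ground set into S, T and one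
    further element. *)
Lemma odd_adj_third (S T : V) : odd_adj S T ->
  exists u, [/\ u \notin val S, u \notin val T, ~: val S = u |: val T & ~: val T = u |: val S].
Proof.
rewrite /odd_adj => dST; have: #|~: (val S :|: val T)| == 1%N.
  rewrite cardsCs setCK card_ord cardsU disjoint_setI0 // cards0 subn0.
  by rewrite (eqP (valP S)) (eqP (valP T)) mul2n -addnn addKn.
case/cards1P => u def_u; exists u.
have := in_setC u (val S :|: val T); rewrite def_u inE eqxx => /esym; rewrite inE negb_or.
case/andP=> uS uT; split=> //; apply/setP => i;
  have /setP/(_ i) := def_u; have := disjointFr dST (x := i); rewrite !inE;
  case: (i \in val S); case: (i \in val T) => D <- //;
  by have := D isT.
Qed.

Lemma dead_edge (S T : V) u : dead S -> u \notin val S -> u \notin val T ->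
    ~: val S = u |: val T -> ~: val T = u |: val S ->
  w ('X * set_poly (val T)) (set_poly (~: val T)) =
  node u * w (set_poly (val T)) (set_poly (~: val T)).
Proof.
move=> [S0 S1] uS uT defS defT; apply/eqP.
rewrite -subr_eq0 -(altZl w_alt) -(altBl w_alt) -mulXsubC -set_polyU1 // -defS.
rewrite defT set_polyU1 // mulXsubC (altBr w_alt) (altZr w_alt).
by rewrite !(w_alt.2 (set_poly (~: _))) S0 S1 !oppr0 mulr0 subrr.
Qed.

(** An affine function of u with two zeros is zero: this is where the threshold 2 of
    the process matches the dimension 2 of the edge vectors at a vertex. *)
Lemma dead_step (T S1 S2 : V) : odd_adj T S1 -> odd_adj T S2 -> S1 != S2 ->
  dead S1 -> dead S2 -> dead T.
Proof.
move=> /odd_adj_third[u1 [uT1 uS1 dT1 dS1]] /odd_adj_third[u2 [uT2 uS2 dT2 dS2]] neqS D1 D2.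
have E1 := dead_edge D1 uS1 uT1 dS1 dT1; have E2 := dead_edge D2 uS2 uT2 dS2 dT2.
have neq_u : node u1 - node u2 != 0.
  rewrite subr_eq0 (inj_eq node_inj); apply: contra_neq neqS => eq_u.
  by apply: val_inj; rewrite -[LHS](setU1K uS1) -[RHS](setU1K uS2) -dT1 -dT2 eq_u.
have T0 : w (set_poly (val T)) (set_poly (~: val T)) = 0.
  by apply/(mulfI neq_u); rewrite mulr0 mulrBl -E1 -E2 subrr.
by split=> //; rewrite E1 T0 mulr0.
Qed.

Lemma dead_bootstrap (A : {set V}) t : (forall S, S \in A -> dead S) ->
  forall S, S \in bootstrap (@odd_adj k) 2 A t -> dead S.
Proof.
move=> deadA; elim: t => [//|t IHt] T; rewrite /bootstrap iterS -/(bootstrap _ _ _ _).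
rewrite !inE => /orP[/IHt//|/card_gt1P[S1 [S2 []]]]; rewrite !inE.
move=> /andP[/IHt D1 adj1] /andP[/IHt D2 adj2] neqS; exact: dead_step neqS D1 D2.
Qed.

Lemma all_dead_eq0 : (0 < k)%N -> (forall S : V, dead S) ->
  forall i j, (i <= k.+1)%N -> (j <= k.+1)%N -> w 'X^i 'X^j = 0.
Proof.
move=> k_gt0 all_dead.
have [n def_k] : exists n, k = n.+1 by exists k.-1; rewrite prednK.
rewrite def_k; apply: (alternating_eq0 (s := enum 'I_(2 * k + 1)) node_inj) => //.
- exact: enum_uniq.
- by rewrite size_enum_ord def_k.
move=> u S T perm_uST; rewrite -def_k => size_S size_T.
have := perm_uniq perm_uST; rewrite enum_uniq /= mem_cat negb_or cat_uniq.
case/andP=> /andP[uS uT] /and3P[S_uniq dST T_uniq].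
pose sS := [set i in S]; pose sT := [set i in T].
have mem_all i : i \in u :: S ++ T by rewrite (perm_mem perm_uST) mem_enum.
have card_S : #|sS| == k by rewrite cardsE (card_uniqP S_uniq) size_S.
have def_CS : ~: sS = u |: sT.
  apply/setP => i; rewrite !inE; have := mem_all i; rewrite inE mem_cat.
  case: (eqVneq i u) => [->|_] /=; first by rewrite uS.
  case iS: (i \in S) => /=; last by move=> ->.
  by move=> _; apply/esym/negbTE; apply: contra dST => iT; apply/hasP; exists i.
have roots_set L : uniq L -> roots_prod node L = set_poly [set i in L].
  move=> L_uniq; rewrite /roots_prod big_uniq //=.
  by apply: eq_bigl => i; rewrite inE.
have [D0 D1] := all_dead (Sub sS card_S); rewrite /= def_CS in D0 D1.
have roots_cons L : roots_prod node (u :: L) = ('X - (node u)%:P) * roots_prod node L.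
  by rewrite /roots_prod big_cons.
rewrite !roots_cons !roots_set // -[X in w _ X]set_polyU1 ?inE // mulXsubC.
by rewrite (altBl w_alt) (altZl w_alt) D0 D1 mulr0 subrr.
Qed.

End OddLower.

(** Each initial vertex imposes two linear conditions on an alternating form, and
    the process propagates them to every vertex, where only the zero form is left. *)
Lemma percolating_card k (A : {set odd_vertex k}) : (0 < k)%N ->
  percolating (@odd_adj k) 2 A -> ('C(k.+2, 2) <= 2 * #|A|)%N.
Proof.
move=> k_gt0 [t percA]; rewrite leqNgt; apply/negP; rewrite mul2n -addnn => lt_A.
pose S (c : 'I_(#|A| + #|A|)) := match split c with inl i | inr i => val (enum_val i) end.
pose f c :=
  if split c is inl _ then set_poly rat (S c) else 'X * set_poly rat (S c).
have [w [w_alt wA w_neq0]] := exists_alternating f (fun c => set_poly rat (~: S c)) lt_A.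
apply: w_neq0; apply: all_dead_eq0 => // T.
apply: (dead_bootstrap w_alt (A := A) (t := t)) => [{}T AT|]; last by rewrite percA inE.
split; [have := wA (unsplit (inl (enum_rank_in AT T)))
      | have := wA (unsplit (inr (enum_rank_in AT T)))];
  by rewrite /f /S unsplitK enum_rankK_in.
Qed.

Theorem theorem1p2 (k : nat) (hk : (0 < k)%N) :
  (k%:R ^+ 2 + 2 * k%:R + 3) / 4 <= (min_percolating (@odd_adj k) 2)%:R :> rat
  /\ (min_percolating (@odd_adj k) 2)%:R
       <= (k%:R ^+ 2 + 5 * k%:R + 3) / 3 :> rat.
Proof.
split; last first.
  rewrite ler_pdivlMr // mulrC -natrX -!natrM -!natrD ler_nat.
  exact: min_percolating_upper.
have [A percA <-] := min_percolating_witness (@odd_adj k) 2.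
have := percolating_card hk percA; rewrite bin2 => le_A.
rewrite ler_pdivrMr // -natrX -!natrM -!natrD ler_nat.
by move: #|A| le_A => m; nia.
Qed.
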